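(* Let $U$ be an optimal prefix-free machine and let $f:2^\omega\to[0,1]$, $f(x)=\sum_{\sigma\le_L x}2^{-K_U(\sigma)}$. Then $\dim_H(f(2^\omega))=1$, where $\dim_H$ denotes Hausdorff dimension.
   Context: A machine is a partial computable function $M$ from $2^{<\omega}$ to $2^{<\omega}$; it is prefix-free if its domain is a prefix-free set. $K_M(\sigma)=\min\{|\tau|: M(\tau)=\sigma\}$ ($=\infty$ if there is no such $\tau$, with $2^{-\infty}=0$). A prefix-free machine $U$ is optimal if for each prefix-free machine $M$ there is a constant $c$ with $K_U(\sigma)\le K_M(\sigma)+c$ for all $\sigma$. For $\sigma\in 2^{<\omega}$ and $x\in 2^\omega$, $\sigma<_L x$ means that there is $n$ with $\sigma\upharpoonright n=x\upharpoonright n$, $\sigma(n)=0$ and $x(n)=1$; $\sigma\le_L x$ means that $\sigma<_L x$ or $\sigma$ is an initial segment of $x$. *)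

(* Defs.v *)
From HB Require Import structures.
From mathcomp Require Import all_boot all_order all_algebra.
From mathcomp Require Import all_classical all_reals all_analysis.

Set Implicit Arguments.
Unset Strict Implicit.
Unset Printing Implicit Defensive.

Import Order.TTheory GRing.Theory Num.Theory.

(* Kleene's partial recursive functions: syntax, then graph semantics. *)
Inductive recfun : nat -> Type :=
| Zero : recfun 0
| Succ : recfun 1
| Proj n (i : 'I_n) : recfun n
| Comp n m (f : recfun m) (g : 'I_m -> recfun n) : recfun n
| Prec n (f : recfun n) (g : recfun n.+2) : recfun n.+1
| Mu n (f : recfun n.+1) : recfun n.

(* Recursion and minimization act on the first argument. In the Prec case,
   s lists the successive values of the recursion up to the first argument. *)
Fixpoint rec_eval n (e : recfun n) : n.-tuple nat -> nat -> Prop :=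
  match e in recfun n return n.-tuple nat -> nat -> Prop with
  | Zero => fun _ y => y = 0
  | Succ => fun v y => y = (thead v).+1
  | Proj _ i => fun v y => y = tnth v i
  | Comp _ m f g => fun v y =>
      exists2 w : m.-tuple nat,
        (forall i, rec_eval (g i) v (tnth w i)) & rec_eval f w y
  | Prec _ f g => fun v y =>
      exists s : nat -> nat,
        [/\ rec_eval f (behead_tuple v) (s 0),
            forall i, i < thead v ->
              rec_eval g [tuple of i :: s i :: behead_tuple v] (s i.+1)
          & y = s (thead v)]
  | Mu _ f => fun v y =>
      rec_eval f [tuple of y :: v] 0 /\
      (forall z, z < y -> exists k, rec_eval f [tuple of z :: v] k.+1)
  end.

(* Position in the length-lexicographic enumeration
   [::], 0, 1, 00, 01, 10, 11, 000, ... of the binary strings. *)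
Definition string_code (s : seq bool) : nat :=
  foldl (fun n (b : bool) => n.*2 + b.+1) 0 s.

Lemma string_code_bij : bijective string_code.
Proof.
have codeE s b : string_code (rcons s b) = (string_code s).*2 + b.+1.
  by rewrite /string_code foldl_rcons.
have surj n : exists s, string_code s = n.
  elim/ltn_ind: n => -[|n] IH; first by exists [::].
  have [|s sE] := IH n./2; first by rewrite ltnS -divn2 leq_div.
  exists (rcons s (odd n)).
  by rewrite codeE sE addnS addnC odd_double_half.
have inj : injective string_code.
  elim/last_ind => [|s b IH] t; elim/last_ind: t => [|t c _] //.
  - by rewrite codeE addnS.
  - by rewrite codeE addnS.
  rewrite !codeE !addnS => -[e].
  have eb : b = c.
    by have := congr1 odd e; rewrite !oddD !odd_double !oddb.
  subst c; congr rcons; apply: IH; apply: double_inj.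
  exact: (addIn e).
exists (fun n => sval (cid (surj n))) => [s|n]; last exact: (svalP (cid (surj n))).
exact/inj/(svalP (cid (surj _))).
Qed.

(* Partial functions on binary strings are option-valued; None is divergence. *)
Definition partial_computable (M : seq bool -> option (seq bool)) : Prop :=
  exists e : recfun 1, forall s t : seq bool,
    M s = Some t <-> rec_eval e [tuple string_code s] (string_code t).

Definition prefix_free (M : seq bool -> option (seq bool)) : Prop :=
  forall s t : seq bool, M s -> M t -> prefix s t -> s = t.

Definition prefix_free_machine (M : seq bool -> option (seq bool)) : Prop :=
  partial_computable M /\ prefix_free M.

(* Values in the naturals extended by +oo; -oo is never taken. *)
Definition complexity (M : seq bool -> option (seq bool)) (s : seq bool)
    : \bar int :=
  match pselect (exists n, `[< exists2 t, M t = Some s & size t = n >]) with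
  | left h => (Posz (ex_minn h))%:E%E
  | right _ => +oo%E
  end.

Definition optimal (U : seq bool -> option (seq bool)) : Prop :=
  prefix_free_machine U /\
  forall M, prefix_free_machine M ->
    exists c : nat, forall s : seq bool,
      (complexity U s <= complexity M s + (Posz c)%:E)%E.

Definition ltL (s : seq bool) (x : nat -> bool) : Prop :=
  exists n, [/\ n < size s, take n s = mkseq x n,
                nth false s n = false & x n = true].

Definition leL (s : seq bool) (x : nat -> bool) : Prop :=
  ltL s x \/ s = mkseq x (size s).

Local Open Scope classical_set_scope.
Local Open Scope ring_scope.

(* 2^-k, with 2^-oo = 0. *)
Definition exp2N (R : realType) (k : \bar int) : R :=
  if k is m%:E%E then 2 ^ (- m) else 0.

(* By Kraft's inequality the sum is at most 1 when U is prefix-free, so [fine]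
   loses nothing. *)
Definition sumL (R : realType) (U : seq bool -> option (seq bool))
    (x : nat -> bool) : R :=
  fine (\esum_(s in [set s | leL s x]) (exp2N R (complexity U s))%:E).

Section hausdorff.
Context {R : realType}.
Implicit Types (A : set R) (s delta : R).
Local Open Scope ereal_scope.

Definition diameter A : \bar R :=
  ereal_sup [set (`|x.1 - x.2|%R)%:E | x in A `*` A].

(* The empty set is treated apart so that it contributes 0 also when s = 0. *)
Definition diam_pow s A : \bar R :=
  if A == set0 then 0 else diameter A `^ s.

Definition hausdorff_content s delta A : \bar R :=
  ereal_inf [set \sum_(0 <= i <oo) diam_pow s (C i) | C in
    [set C : nat -> set R | A `<=` \bigcup_i C i /\
                            forall i, diameter (C i) <= delta%:E]].

Definition hausdorff_measure s A : \bar R :=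
  ereal_sup [set hausdorff_content s delta A | delta in [set d : R | (0 < d)%R]].

Definition hausdorff_dim A : \bar R :=
  ereal_inf [set s%:E | s in [set s : R | (0 <= s)%R /\
                                          hausdorff_measure s A = 0]].

End hausdorff.

(* Main.v *)
Require Import Defs.
From mathcomp Require Import all_boot all_order all_algebra.
From mathcomp Require Import all_classical all_reals all_analysis.
From mathcomp Require Import zify ring lra.

(** Write f for [sumL R U] and K for [complexity U].

    Upper bound. Shortest programs of distinct strings form a prefix-free set,
    so Kraft's inequality [kraft] gives [0 <= f <= 1]; and a subset of [0, 1]
    has dimension at most 1 ([hausdorff_measure_sub01]).

    Lower bound. On the binary expansions x of the numbers t in [0, 1[, the
    map f(x) |-> t is Hoelder of every exponent s < 1, and its values cover
    [0, 1[. A set with such an image has positive s-dimensional measure: a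
    cover of it induces a cover of [0, 1[ by intervals whose total length, at
    least 1, is at most a constant times the sum of the s-th powers of the
    diameters ([hausdorff_measure_neq0]).

    For the Hoelder estimate let t < u lie in [0, 1[ with binary expansions x
    and y, and let m be least with 2^-m <= u - t. The expansions branch before
    position m, so the string y|m lies weakly to the left of y but not of x,
    and therefore f(y) - f(x) >= 2^-K(y|m) ([sumL_gap], [digit_split]).
    It remains to bound K(y|m) by about m. A plain self-delimiting code
    suffices: for each k > 0 the map [encode k] is injective with prefix-free
    range, and sends strings of length n to strings of length at most
    (1 + 1/k) n + k + 1. As [encode k] is recursive, its inverse is a
    prefix-free machine ([left_inverse_machine]), so by optimality
    K(y|m) <= (1 + 1/k) m + O(1). Taking k so large that s (1 + 1/k) <= 1
    yields (f(y) - f(x))^s >= 2^-(m + O(1)) >= c (u - t)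
    ([exp2N_complexity_powR_ge], [sumL_digit_expand]). *)

Set Implicit Arguments.
Unset Strict Implicit.
Unset Printing Implicit Defensive.

Import Order.TTheory GRing.Theory Num.Theory.

(** * Total recursive functions *)

(** Totality is what makes this class easy to handle: closure under the
    constructors becomes a statement about functions rather than graphs.
    Partiality enters only at the single search in [left_inverse_machine]. *)
Definition recursive n (F : n.-tuple nat -> nat) : Prop :=
  exists e : recfun n, forall v y, rec_eval e v y <-> y = F v.

Lemma eq_recursive n (F G : n.-tuple nat -> nat) :
  F =1 G -> recursive F -> recursive G.
Proof. by move=> FG [e eP]; exists e => v y; rewrite eP FG. Qed.

Lemma recursive_tnth n (i : 'I_n) : recursive (fun v => tnth v i).
Proof. by exists (Proj i). Qed.

Lemma recursive_comp n m (F : m.-tuple nat -> nat) (G : 'I_m -> n.-tuple nat -> nat) :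
  recursive F -> (forall i, recursive (G i)) ->
  recursive (fun v => F [tuple G i v | i < m]).
Proof.
move=> [f fP] /choice[g gP]; exists (Comp f g) => v y /=; split.
  case=> w wP /fP ->; congr F; apply: eq_from_tnth => i.
  by rewrite tnth_mktuple; apply/gP/wP.
move=> ->; exists [tuple G i v | i < m]; last exact/fP.
by move=> i; apply/gP; rewrite tnth_mktuple.
Qed.

Lemma recursive_comp1 n (f : nat -> nat) (G : n.-tuple nat -> nat) :
  recursive (fun v : 1.-tuple nat => f (thead v)) -> recursive G ->
  recursive (fun v => f (G v)).
Proof.
move=> rf rG; apply: eq_recursive (recursive_comp rf (fun=> rG)) => v.
by rewrite /thead tnth_mktuple.
Qed.

Lemma recursive_comp2 n (f : nat -> nat -> nat) (G H : n.-tuple nat -> nat) :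
  recursive (fun v : 2.-tuple nat => f (tnth v ord0) (tnth v ord_max)) ->
  recursive G -> recursive H -> recursive (fun v => f (G v) (H v)).
Proof.
move=> rf rG rH.
pose K (i : 'I_2) := if i == ord0 then G else H.
have rK i : recursive (K i) by rewrite /K; case: ifP.
by apply: eq_recursive (recursive_comp rf rK) => v; rewrite !tnth_mktuple.
Qed.

Lemma recursive_succ n (F : n.-tuple nat -> nat) :
  recursive F -> recursive (fun v => (F v).+1).
Proof. by apply: (@recursive_comp1 _ succn); exists Succ. Qed.

Lemma recursive_const n c : recursive (fun _ : n.-tuple nat => c).
Proof.
elim: c => [|c IH]; last exact: recursive_succ.
have r0 : recursive (fun _ : 0.-tuple nat => 0) by exists Zero.
by apply: (recursive_comp (G := fun i : 'I_0 => fun=> 0) r0) => -[].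
Qed.

Lemma recursive_prec n (F : n.-tuple nat -> nat) (G : n.+2.-tuple nat -> nat) :
  recursive F -> recursive G ->
  recursive (fun v : n.+1.-tuple nat =>
    iteri (thead v) (fun i a => G [tuple of i :: a :: behead_tuple v])
          (F (behead_tuple v))).
Proof.
move=> [f fP] [g gP]; exists (Prec f g) => v y /=; split=> [|->].
  case=> s [/fP s0 sS ->].
  suff: forall j, j <= thead v ->
    s j = iteri j (fun i a => G [tuple of i :: a :: behead_tuple v])
                  (F (behead_tuple v)) by apply.
  elim=> [//|j IH] lt_j.
  by have /gP := sS j lt_j; rewrite /= -IH// ltnW.
exists (fun j => iteri j (fun i a => G [tuple of i :: a :: behead_tuple v])
                         (F (behead_tuple v))).
by split=> //[|i _]; [apply/fP | apply/gP].
Qed.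

(** All the arithmetic below is iteration, as often as one argument says, of
    a step that may consult the other one. *)
Lemma recursive_iteri (g : nat -> nat -> nat -> nat) (f : nat -> nat) n
    (M X : n.-tuple nat -> nat) :
  recursive (fun v : 3.-tuple nat =>
    g (tnth v (@Ordinal 3 0 isT)) (tnth v (@Ordinal 3 1 isT))
      (tnth v (@Ordinal 3 2 isT))) ->
  recursive (fun v : 1.-tuple nat => f (thead v)) ->
  recursive M -> recursive X ->
  recursive (fun v => iteri (M v) (fun i a => g i a (X v)) (f (X v))).
Proof.
move=> rg rf; apply: (@recursive_comp2 _ (fun m x => iteri m (fun i a => g i a x) (f x))).
apply: eq_recursive (recursive_prec rf rg) => v.
case/tupleP: v => m v; case/tupleP: v => x v; rewrite !theadE (tuple0 v).
have -> : tnth [tuple of m :: [tuple of x :: [tuple]]] ord_max = x by [].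
by congr (iteri _ _ (f _)).
Qed.

Lemma recursive_pred n (F : n.-tuple nat -> nat) :
  recursive F -> recursive (fun v => (F v).-1).
Proof.
move=> rF.
have := @recursive_iteri (fun i a x => i) (fun x => 0) _ _ _
    (recursive_tnth (@Ordinal 3 0 isT)) (recursive_const 1 0) rF rF.
by apply: eq_recursive => v; case: (F v).
Qed.

Lemma recursive_add n (F G : n.-tuple nat -> nat) :
  recursive F -> recursive G -> recursive (fun v => F v + G v).
Proof.
move=> rF rG.
have := @recursive_iteri (fun i a x => a.+1) (fun x => x) _ _ _
    (recursive_succ (recursive_tnth (@Ordinal 3 1 isT)))
  (recursive_tnth (@ord0 0)) rF rG.
by apply: eq_recursive => v; elim: (F v) => //= m ->.
Qed.

Lemma recursive_sub n (F G : n.-tuple nat -> nat) :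
  recursive F -> recursive G -> recursive (fun v => F v - G v).
Proof.
move=> rF rG.
have := @recursive_iteri (fun i a x => a.-1) (fun x => x) _ _ _
    (recursive_pred (recursive_tnth (@Ordinal 3 1 isT)))
  (recursive_tnth (@ord0 0)) rG rF.
by apply: eq_recursive => v; elim: (G v) => [|m /= ->]; rewrite ?subn0 ?subnS.
Qed.

Lemma recursive_mul n (F G : n.-tuple nat -> nat) :
  recursive F -> recursive G -> recursive (fun v => F v * G v).
Proof.
move=> rF rG.
have := @recursive_iteri (fun i a x => x + a) (fun x => 0) _ _ _
    (recursive_add (recursive_tnth (@Ordinal 3 2 isT))
    (recursive_tnth (@Ordinal 3 1 isT)))
  (recursive_const 1 0) rF rG.
by apply: eq_recursive => v; elim: (F v) => //= m ->.
Qed.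

Lemma recursive_exp2 n (F : n.-tuple nat -> nat) :
  recursive F -> recursive (fun v => 2 ^ F v).
Proof.
move=> rF.
have := @recursive_iteri (fun i a x => a + a) (fun x => 1) _ _ _
    (recursive_add (recursive_tnth (@Ordinal 3 1 isT))
    (recursive_tnth (@Ordinal 3 1 isT)))
  (recursive_const 1 1) rF rF.
by apply: eq_recursive => v; elim: (F v) => //= m ->; rewrite expnS mul2n addnn.
Qed.

(** Minimization is stated through its result h, known in advance, so that
    the function stays total. *)
Lemma recursive_mu n (P : nat -> n.-tuple nat -> nat) (h : n.-tuple nat -> nat) :
  recursive (fun v : n.+1.-tuple nat => P (thead v) (behead_tuple v)) ->
  (forall v, P (h v) v = 0) -> (forall v z, z < h v -> P z v != 0) ->
  recursive h.
Proof.
move=> [e eP] P0 PN0; exists (Mu e) => v y /=.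
have eE z w : rec_eval e [tuple of z :: v] w <-> w = P z v.
  by rewrite eP theadE; have -> : behead_tuple [tuple of z :: v] = v by exact: val_inj.
split=> [[/eE Py ltP]|->].
  have [/PN0|/ltP[k /eE]|//] := ltngtP y (h v); first by rewrite -Py eqxx.
  by rewrite P0.
split=> [|z /PN0]; first by apply/eE; rewrite P0.
by case E: (P z v) => [//|k] _; exists k; apply/eE.
Qed.

(** * Binary strings and their codes *)

(** Since [(string_code s).+1] is the number with binary expansion 1s,
    appending t shifts it by [size t] binary places. *)
Lemma string_code_cat s t :
  string_code (s ++ t) = string_code s * 2 ^ size t + string_code t.
Proof.
elim/last_ind: t => [|t b IH]; first by rewrite cats0 muln1 addn0.
by rewrite -rcons_cat /string_code !foldl_rcons -!/(string_code _) IH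
  size_rcons expnS; lia.
Qed.

Lemma string_code_bounds s :
  2 ^ size s <= (string_code s).+1 < 2 ^ (size s).+1.
Proof.
elim/last_ind: s => [//|s b].
rewrite /string_code foldl_rcons -/(string_code _) size_rcons !expnS.
by case: b => /=; lia.
Qed.

Lemma string_code_nseq0 a : (string_code (nseq a false)).+1 = 2 ^ a.
Proof.
elim: a => [//|a IH]; rewrite -[a.+1]addn1 nseqD string_code_cat/= expnD -IH.
by rewrite /string_code/=; lia.
Qed.

Definition recursive_map (E : seq bool -> seq bool) : Prop :=
  exists F : nat -> nat, recursive (fun v : 1.-tuple nat => F (thead v)) /\
    forall t, string_code (E t) = F (string_code t).

(** The machine searches for t with E(t) equal to its input: the search may
    diverge, but the tested function is total. The hypothesis on prefixes makes
    the machine prefix-free and E injective, so that at most one t can be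
    found. *)
Lemma left_inverse_machine (E : seq bool -> seq bool) :
  recursive_map E -> (forall s t, prefix (E s) (E t) -> s = t) ->
  exists2 M, prefix_free_machine M & forall t, M (E t) = Some t.
Proof.
move=> [F [rF FE]] prefE.
have [dec codeK decK] := string_code_bij.
pose M s := if pselect (exists t, E t = s) is left h then Some (sval (cid h)) else None.
have ME s t : M s = Some t <-> E t = s.
  rewrite /M; case: pselect => [h|nh]; last first.
    by split=> // Et; case: nh; exists t.
  case: cid => u Eu /=; split=> [[<-//]|Et]; congr Some; apply: prefE.
  by rewrite Et Eu prefix_refl.
exists M; last by move=> t; apply/ME.
split; last first.
  move=> s t; case Ms: (M s) => [u|//] _; case Mt: (M t) => [w|//] _.
  by move/ME: Ms Mt => <- /ME <- /prefE ->.
have r0 : recursive (fun v : 2.-tuple nat => F (tnth v ord0)).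
  exact: recursive_comp1 rF (recursive_tnth _).
have r1 := recursive_tnth (@ord_max 1).
(* The symmetric truncated difference vanishes exactly at equality. *)
have [e eP] := recursive_add (recursive_sub r1 r0) (recursive_sub r0 r1).
exists (Mu e) => s t; rewrite ME /=.
have eE z w : rec_eval e [tuple of z :: [tuple string_code s]] w <->
    w = (string_code s - F z) + (F z - string_code s) by rewrite eP.
have F_inj y z : F y = F z -> y = z.
  rewrite -(decK y) -(decK z) -!FE => /(can_inj codeK) Eyz; congr string_code.
  by apply: prefE; rewrite Eyz prefix_refl.
split=> [Et|[/eE + _]].
  split=> [|z ltz]; first by apply/eE; rewrite -FE Et subnn.
  case Es : ((string_code s - F z) + (F z - string_code s)) => [|k]; last first.
    by exists k; apply/eE; rewrite Es.
  suff /F_inj zt : F z = F (string_code t) by rewrite zt ltnn in ltz.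
  by rewrite -FE Et; lia.
move=> F0; apply: (can_inj codeK); rewrite FE; lia.
Qed.

(** * A recursive prefix-free code of rate close to one *)

Definition blocks k (t : seq bool) : nat := (size t %/ k).+1.

(** The length is rounded up to a multiple of k that exceeds [size t], which
    leaves room for the leading 1 that marks where t starts. *)
Definition pad k (t : seq bool) : seq bool :=
  nseq (k * blocks k t - (size t).+1) false ++ true :: t.

(** The unary prefix announces the number of blocks of length k that follow.
    A unary header for [size t] itself would double the length; counting
    blocks costs only one bit per k bits. *)
Definition encode k (t : seq bool) : seq bool :=
  nseq (blocks k t).-1 false ++ true :: pad k t.

Lemma size_pad k t : 0 < k -> size (pad k t) = k * blocks k t.
Proof.
move=> k0; rewrite size_cat size_nseq /= subnK//.
by rewrite mulnC /blocks {1}(divn_eq (size t) k) mulSn addnC -addSn leq_add2r ltn_mod.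
Qed.

Lemma size_encode k t : 0 < k -> size (encode k t) = k.+1 * blocks k t.
Proof. by move=> k0; rewrite size_cat size_nseq /= size_pad// mulSn addnS. Qed.

Lemma unary_prefix a b u w :
  prefix (nseq a false ++ true :: u) (nseq b false ++ true :: w) ->
  a = b /\ prefix u w.
Proof.
elim: a b => [|a IH] [|b]; rewrite ?cat0s ?cat_cons ?prefix_cons //=.
by move=> /IH[-> ?].
Qed.

Lemma encode_prefix k s t : 0 < k -> prefix (encode k s) (encode k t) -> s = t.
Proof.
move=> k0 /unary_prefix[eq_blocks pref].
have : pad k s == pad k t.
  move: pref; rewrite prefixE => /eqP <-; rewrite take_oversize//.
  by rewrite !size_pad// /blocks -[size t %/ k]eq_blocks.
move/eqP => pad_st.
have /unary_prefix[eq_pad] : prefix (pad k s) (pad k t) by rewrite pad_st prefix_refl.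
move: pad_st; rewrite /pad eq_pad => /eqP; rewrite eqseq_cat// => /andP[_ /eqP[->]] //.
Qed.

(** Each of the two markers 0..01 contributes one power of 2, whose exponent
    is the length of the string that starts with the marker. *)
Lemma string_code_encode k t : 0 < k ->
  string_code (encode k t) =
  2 ^ (k.+1 * blocks k t) + 2 ^ (k * blocks k t) + string_code t.
Proof.
move=> k0.
have unaryE a u : string_code (nseq a false ++ true :: u) =
    2 ^ (a.+1 + size u) + string_code u.
  rewrite -cat1s catA string_code_cat; congr (_ + _).
  rewrite string_code_cat expnD expnS -(string_code_nseq0 a).
  have -> : string_code [:: true] = 2 by [].
  by congr (_ * _); rewrite /=; lia.
rewrite unaryE unaryE -addnA; congr (2 ^ _ + (2 ^ _ + _)).
  by rewrite size_pad// mulSn.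
by rewrite -[RHS](size_pad t k0) size_cat size_nseq/= addnS.
Qed.

(** In the closed form of [string_code_encode] only the number of blocks is
    not arithmetic in the code of t; it is the least b with
    [(string_code t).+1 < 2 ^ (k * b)]. *)
Lemma recursive_encode k : 0 < k -> recursive_map (encode k).
Proof.
move=> k0; have [dec codeK decK] := string_code_bij.
pose B (v : 1.-tuple nat) := blocks k (dec (thead v)).
have r1 : recursive (fun v : 1.-tuple nat => thead v) := recursive_tnth _.
have rB : recursive B.
  apply: (@recursive_mu _ (fun b v => (thead v).+2 - 2 ^ (k * b))).
  - apply: recursive_sub; last first.
      exact: recursive_exp2 (recursive_mul (recursive_const _ _) (recursive_tnth _)).
    apply: recursive_succ; apply: recursive_succ.
    apply: eq_recursive (recursive_tnth ord_max) => v.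
    by case/tupleP: v => x v; case/tupleP: v => y v.
  - move=> v; apply/eqP; rewrite subn_eq0 -{1}(decK (thead v)) -ltnS.
    have /andP[_ lt1] := string_code_bounds (dec (thead v)).
    apply: leq_trans lt1 _; rewrite leq_exp2l// -(size_pad _ k0).
    by rewrite size_cat/= addnS ltnS leq_addl.
  - move=> v b ltb; rewrite subn_eq0 -ltnNge ltnS -{1}(decK (thead v)).
    have /andP[le1 _] := string_code_bounds (dec (thead v)).
    apply: leq_trans le1; rewrite leq_exp2l// mulnC.
    by rewrite -leq_divRL// -ltnS.
exists (fun y => 2 ^ (k.+1 * blocks k (dec y)) + 2 ^ (k * blocks k (dec y)) + y).
split; last by move=> t; rewrite string_code_encode// codeK.
do ![apply: recursive_add => //]; apply: recursive_exp2;
  exact: recursive_mul (recursive_const _ _) rB.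
Qed.

Local Open Scope classical_set_scope.
Local Open Scope ring_scope.

(** * Kraft's inequality and the sums over initial parts *)

(** Induction on a bound for the lengths: if the empty string is present it is
    alone, and otherwise the strings split by first bit into two prefix-free
    families of tails, each contributing half of a sum that is at most 1. *)
Lemma kraft (R : realFieldType) (ps : seq (seq bool)) :
  uniq ps -> {in ps &, forall p q, prefix p q -> p = q} ->
  \sum_(p <- ps) (2^-1 : R) ^+ size p <= 1.
Proof.
have [L szL] : exists L, {in ps, forall p, (size p < L)%N}.
  exists (\max_(p <- ps) size p).+1%N => p pps; rewrite ltnS.
  by rewrite (big_rem p pps) leq_maxl.
elim: L ps szL => [|L IH] ps szL ups pf.
  case: ps szL {ups pf} => [|p ps]; first by rewrite big_nil ler01.
  by move=> /(_ p (mem_head _ _)).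
have [nil_ps|nil_ps] := boolP ([::] \in ps).
  have eqnil p : p \in ps -> p = [::].
    by move=> pps; rewrite (pf _ _ nil_ps pps (prefix0s p)).
  case: ps ups eqnil {pf szL IH nil_ps} => [|p [|q ps]] /=.
  - by rewrite big_nil ler01.
  - by move=> _ eqnil; rewrite big_seq1 (eqnil p) ?mem_head// expr0.
  - move=> /andP[+ _] eqnil; rewrite [p]eqnil ?mem_head// [q]eqnil ?mem_head//.
    by rewrite !inE eqxx orbT.
pose tails b := [seq behead p | p <- ps & ohead p == Some b].
have tailsP b q : (q \in tails b) = (b :: q \in ps).
  apply/mapP/idP => [[[|c p]]|bq]; rewrite ?mem_filter//=.
    by move=> /andP[/eqP[->]] pps ->.
  by exists (b :: q) => //; rewrite mem_filter/= eqxx.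
have half b : \sum_(p <- ps | ohead p == Some b) (2^-1 : R) ^+ size p <= 2^-1.
  have -> : \sum_(p <- ps | ohead p == Some b) (2^-1 : R) ^+ size p =
            2^-1 * \sum_(q <- tails b) (2^-1 : R) ^+ size q.
    rewrite big_map big_filter mulr_sumr; apply: eq_bigr => -[|c p] //= _.
    by rewrite exprS.
  rewrite ger_pMr ?invr_gt0//; apply: IH => [q|| p q].
  - by rewrite tailsP => /szL.
  - rewrite map_inj_in_uniq ?filter_uniq// => -[|c p] [|d q];
      rewrite !mem_filter//= => /andP[/eqP[->] _] /andP[/eqP[->] _] ->.
    by [].
  - rewrite !tailsP => pps qps pq.
    by have := pf _ _ pps qps; rewrite prefix_cons eqxx => /(_ pq)[].
rewrite (bigID (fun p => ohead p == Some true)) /= [leRHS](splitr 1).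
apply: lerD; rewrite div1r; first exact: half.
apply: le_trans (half false).
rewrite le_eqVlt big_seq_cond [X in _ == X]big_seq_cond.
apply/orP; left; apply/eqP/eq_bigl.
by move=> [|[] p]; rewrite ?(negPf nil_ps) /= ?andbF ?andbT.
Qed.

Lemma exp2N_ge0 (R : realType) k : 0 <= exp2N R k.
Proof. by case: k => //= m; exact/exprz_ge0. Qed.

Lemma exp2N_complexityP (R : realType) U s :
  exp2N R (complexity U s) = 0 \/
  exists2 p, U p = Some s & exp2N R (complexity U s) = 2^-1 ^+ size p.
Proof.
rewrite /complexity; case: pselect => [h|_]; last by left.
right; case: ex_minnP => m /asboolP[p Up <-] _; exists p => //=.
by rewrite exprVn exprnN.
Qed.

(** Chosen shortest programs of distinct strings are distinct, so Kraft's
    inequality applies to them. *)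
Lemma sum_exp2N_complexity_le1 (R : realType) U (ss : seq (seq bool)) :
  prefix_free U -> uniq ss -> \sum_(s <- ss) exp2N R (complexity U s) <= 1.
Proof.
move=> pfU uss; pose w s := exp2N R (complexity U s).
have /choice[prog progP] s : exists p, w s != 0 -> U p = Some s /\ w s = 2^-1 ^+ size p.
  have [w0|[p Up wp]] := exp2N_complexityP R U s; last by exists p.
  by exists [::]; rewrite /w w0 eqxx.
rewrite (bigID (fun s => w s != 0)) /= [X in _ + X]big1 ?addr0; last first.
  by move=> s /negPn/eqP.
rewrite -big_filter.
have -> : \sum_(s <- [seq s <- ss | w s != 0]) exp2N R (complexity U s) =
    \sum_(p <- [seq prog s | s <- [seq s <- ss | w s != 0]]) 2^-1 ^+ size p.
  rewrite big_map big_seq [RHS]big_seq; apply: eq_bigr => s.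
  by rewrite mem_filter => /andP[/progP[]].
apply: kraft.
  rewrite map_inj_in_uniq ?filter_uniq// => s t.
  rewrite !mem_filter => /andP[/progP[Us _] _] /andP[/progP[Ut _] _] st.
  by move: Us; rewrite st Ut => -[].
move=> _ _ /mapP[s + ->] /mapP[t + ->].
rewrite !mem_filter => /andP[/progP[Us _] _] /andP[/progP[Ut _] _].
by apply: pfU; rewrite ?Us ?Ut.
Qed.

Lemma esum_exp2N_complexity_le1 (R : realType) U (A : set (seq bool)) :
  prefix_free U -> (\esum_(s in A) (exp2N R (complexity U s))%:E <= 1)%E.
Proof.
move=> pfU; apply: ge_ereal_sup => _ /= [X [finX _] <-].
by rewrite fsbig_finite// sumEFin lee_fin sum_exp2N_complexity_le1// finmap.fset_uniq.
Qed.

(** Kraft's inequality makes the sum finite, so [fine] only removes a constructor. *)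
Lemma sumLE (R : realType) U x : prefix_free U ->
  (sumL R U x)%:E = \esum_(s in [set s | leL s x]) (exp2N R (complexity U s))%:E.
Proof.
move=> pfU; rewrite fineK// ge0_fin_numE; last first.
  by apply: esum_ge0 => s _; rewrite lee_fin exp2N_ge0.
by apply: le_lt_trans (esum_exp2N_complexity_le1 _ _ pfU) _; rewrite ltry.
Qed.

Lemma sumL_itv (R : realType) U x : prefix_free U -> 0 <= sumL R U x <= 1.
Proof.
move=> pfU; rewrite -!lee_fin sumLE// esum_exp2N_complexity_le1// andbT.
by apply: esum_ge0 => s _; rewrite lee_fin exp2N_ge0.
Qed.

Lemma sumL_gap (R : realType) U x y t : prefix_free U ->
  (forall s, leL s x -> leL s y) -> leL t y -> ~ leL t x ->
  sumL R U x + exp2N R (complexity U t) <= sumL R U y.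
Proof.
move=> pfU xy ty tx; rewrite -lee_fin EFinD !sumLE//.
rewrite [leRHS](esumID [set s | leL s x]); last by move=> s _; rewrite lee_fin exp2N_ge0.
rewrite setIidr//; apply: leeD2l.
apply: esum_ge; exists [set t]; last by rewrite fsbig_set1.
by split=> // _ ->.
Qed.

(** * Complexity of an optimal machine *)

Lemma complexity_le M s t : M s = Some t ->
  (complexity M t <= (Posz (size s))%:E)%E.
Proof.
move=> Ms; rewrite /complexity; case: pselect => [h|[]]; last first.
  by exists (size s); apply/asboolP; exists s.
rewrite lee_fin; case: ex_minnP => m _; rewrite lez_nat; apply.
by apply/asboolP; exists s.
Qed.

Lemma optimal_complexity_le U k : optimal U -> (0 < k)%N ->
  exists c, forall t,
    (complexity U t <= (Posz (k.+1 * (size t %/ k).+1 + c)%N)%:E)%E.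
Proof.
move=> [_ optU] k0.
have [M Mpf ME] := left_inverse_machine (recursive_encode k0)
  (fun s t => @encode_prefix k s t k0).
have [c cP] := optU M Mpf; exists c => t.
apply: le_trans (cP t) _; rewrite PoszD EFinD leeD2r//.
by rewrite -(size_encode t k0); apply: complexity_le.
Qed.

Lemma le_exp2N_complexity (R : realType) U t n :
  (complexity U t <= (Posz n)%:E)%E -> 2^-1 ^+ n <= exp2N R (complexity U t).
Proof.
rewrite /complexity; case: pselect => [h|_]; last by rewrite leye_eq.
case: ex_minnP => m _ _; rewrite lee_fin lez_nat => mn /=.
by rewrite -exprnN -exprVn ler_wiXn2l// ?invr_ge0// invf_le1// ler1n.
Qed.

(** The exponent s < 1 absorbs the overhead factor 1 + 1/k of the code once
    [s * (k + 1) <= k]. *)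
Lemma exp2N_complexity_powR_ge (R : realType) U (s : R) :
  optimal U -> 0 <= s < 1 ->
  exists d, forall t, 2^-1 ^+ (size t + d) <= exp2N R (complexity U t) `^ s.
Proof.
move=> optU /andP[s0 s1]; have s1' : 0 < 1 - s by rewrite subr_gt0.
have [k k_gt0 ks] : exists2 k, (0 < k)%N & s * k.+1%:R <= k%:R.
  exists (Num.truncn (s / (1 - s))).+1 => //.
  have := truncnS_gt (s / (1 - s)); rewrite ltr_pdivrMr//.
  by move: (_.+1) => k lt_s; rewrite -natr1; lra.
have [c cP] := optimal_complexity_le optU k_gt0.
exists (k.+1 + c)%N => t; set q := (size t %/ k)%N.
have half0 : (0 : R) <= 2^-1 by rewrite invr_ge0.
have half1 : 0 < (2^-1 : R) <= 1 by rewrite invr_gt0 ltr0n /= invf_le1// ler1n.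
apply: (@le_trans _ _ ((2^-1 ^+ (k.+1 * q.+1 + c)) `^ s)); last first.
  apply: ge0_ler_powR => //; rewrite ?nnegrE ?exprn_ge0// ?exp2N_ge0//.
  exact/le_exp2N_complexity/cP.
rewrite -!powR_mulrn// -powRrM; apply: ger_powR => //.
have qks : q%:R * (s * k.+1%:R) <= (size t)%:R.
  apply: le_trans (_ : q%:R * k%:R <= _); first by rewrite ler_wpM2l.
  by rewrite -natrM ler_nat leq_trunc_div.
have cs : s * (k.+1%:R + c%:R) <= k.+1%:R + c%:R.
  by rewrite ler_piMl ?ltW// addr_ge0.
have -> : (k.+1 * q.+1 + c)%:R * s =
    q%:R * (s * k.+1%:R) + s * (k.+1%:R + c%:R) :> R.
  by rewrite natrD natrM -[q.+1%:R]natr1; ring.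
by rewrite !natrD lerD.
Qed.

(** * Gaps between values at different branches *)

Lemma take_mkseq T (x : nat -> T) m n :
  (m <= n)%N -> take m (mkseq x n) = mkseq x m.
Proof. by move=> /minn_idPl mn; rewrite /mkseq -map_take take_iota mn. Qed.

Lemma mkseq_eqP (x y : nat -> bool) n :
  mkseq x n = mkseq y n <-> forall i, (i < n)%N -> x i = y i.
Proof.
split=> [e i ltin|e]; last by apply/eq_in_map => i; rewrite mem_iota => /e.
by have := congr1 (nth false ^~ i) e; rewrite !nth_mkseq.
Qed.

(** If x branches to the left of y at position n, every longer initial segment
    of y separates them in the left order. *)
Lemma leL_gap (x y : nat -> bool) n : mkseq x n = mkseq y n ->
  x n = false -> y n = true ->
  (forall s, leL s x -> leL s y) /\
  (forall m, (n < m)%N -> leL (mkseq y m) y /\ ~ leL (mkseq y m) x).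
Proof.
move=> /mkseq_eqP xy xn yn; split=> [s|m ltnm]; last first.
  split; first by right; rewrite size_mkseq.
  case=> [[j [+ + + xj]]|].
    rewrite size_mkseq => ltjm; rewrite take_mkseq; last exact: ltnW.
    move=> /mkseq_eqP yx; rewrite nth_mkseq// => yj.
    have [ltjn|ltnj|ejn] := ltngtP j n.
    - by move: xj; rewrite xy// yj.
    - by move: yn; rewrite yx// xn.
    - by rewrite ejn xn in xj.
  by rewrite size_mkseq => /mkseq_eqP/(_ n ltnm); rewrite xn yn.
case=> [[j [js sj sj0 xj]]|sx].
  left.
  have [ltjn|ltnj|ejn] := ltngtP j n.
  - exists j; split=> //; last by rewrite -xy.
    by rewrite sj; apply/mkseq_eqP => i ij; rewrite xy// (ltn_trans ij).
  - exists n; split=> //; first exact: ltn_trans ltnj js.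
      rewrite -(take_takel s (ltnW ltnj)) sj take_mkseq ?(ltnW ltnj)//.
      exact/mkseq_eqP.
    by rewrite -(nth_take _ ltnj) sj nth_mkseq.
  - by rewrite ejn xn in xj.
have [lens|ltns] := leqP (size s) n.
  by right; rewrite {1}sx; apply/mkseq_eqP => i /leq_trans/(_ lens)/xy.
left; exists n; split=> //.
  by rewrite {1}sx take_mkseq ?(ltnW ltns)//; apply/mkseq_eqP.
by rewrite sx nth_mkseq.
Qed.

(** At dyadic points this is the expansion that ends in zeros. *)
Definition digit (R : realType) (t : R) (n : nat) : bool :=
  odd (Num.truncn (t * 2 ^+ n.+1)).

Lemma truncn_digit (R : realType) (t : R) n : 0 <= t ->
  Num.truncn (t * 2 ^+ n.+1) = (digit t n + (Num.truncn (t * 2 ^+ n)).*2)%N.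
Proof.
move=> t0; rewrite /digit; set p := Num.truncn _.
suff -> : Num.truncn (t * 2 ^+ n) = p./2 by rewrite odd_double_half.
apply: truncn_def.
have t2 : 0 <= t * 2 ^+ n.+1 by rewrite mulr_ge0 ?exprn_ge0.
have := truncn_itv t2; rewrite -/p exprS mulrCA.
have pE : p%:R = (odd p)%:R + 2 * p./2%:R :> R.
  by rewrite -{1}(odd_double_half p) natrD -mul2n natrM.
rewrite -!natr1 pE; case: (odd p) => /=; lra.
Qed.

(** The integer parts P n of t 2^n and Q n of u 2^n agree at n = 0 and differ
    at n = m. Where they first differ they arise from the same number by
    appending one digit each, and Q is the larger. *)
Lemma digit_split (R : realType) (t u : R) m :
  0 <= t -> t < u -> u < 1 -> 2^-1 ^+ m <= u - t ->
  exists n, [/\ (n < m)%N, mkseq (digit t) n = mkseq (digit u) n,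
    digit t n = false & digit u n = true].
Proof.
move=> t0 tu u1 mtu.
have u0 : 0 <= u by exact: le_trans (ltW tu).
pose P n := Num.truncn (t * 2 ^+ n); pose Q n := Num.truncn (u * 2 ^+ n).
have PQm : P m != Q m.
  rewrite neq_ltn; apply/orP; left; rewrite /Q truncn_ge_nat; last by rewrite mulr_ge0.
  have : 1 <= (u - t) * 2 ^+ m.
    by rewrite -ler_pdivrMr ?exprn_gt0// div1r -exprVn.
  have t2 : 0 <= t * 2 ^+ m by rewrite mulr_ge0.
  have /andP[+ _] := truncn_itv t2; rewrite -/(P m) -natr1 mulrBl; lra.
have [[|n] PQn minn] := ex_minnP (ex_intro (fun n => P n != Q n) m PQm).
  move: PQn; rewrite /P /Q !expr0 !mulr1.
  have trunc0 (x : R) : 0 <= x < 1 -> Num.truncn x = 0%N.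
    by move=> x01; apply: truncn_def.
  by rewrite !trunc0 ?eqxx ?u0 ?u1// t0 (lt_trans tu).
have eqPQ i : (i <= n)%N -> P i = Q i.
  by move=> le_in; apply/eqP/negPn/negP => /minn; rewrite ltnNge le_in.
have lePQ : (P n.+1 <= Q n.+1)%N.
  by apply: le_truncn; rewrite ler_pM2r ?exprn_gt0// ltW.
move: PQn lePQ; rewrite /P /Q !truncn_digit// -/(P n) -/(Q n) (eqPQ n (leqnn n)).
rewrite eqn_add2r leq_add2r => ne_digit le_digit.
exists n; split; first exact: minn.
- by apply/mkseq_eqP => i /eqPQ; rewrite /P /Q /digit => ->.
- by move: ne_digit le_digit; case: (digit t n); case: (digit u n).
- by move: ne_digit le_digit; case: (digit t n); case: (digit u n).
Qed.

(** Read backwards, the map from f(x) to the binary value of x is Hoelder of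
    exponent s. *)
Lemma sumL_digit_expand (R : realType) U (s : R) : optimal U -> 0 <= s < 1 ->
  exists2 K, 0 < K & forall t u, 0 <= t < 1 -> 0 <= u < 1 ->
    `|u - t| <= K * `|sumL R U (digit u) - sumL R U (digit t)| `^ s.
Proof.
move=> optU s01; have /andP[s0 _] := s01.
have [d dP] := exp2N_complexity_powR_ge optU s01.
have pfU : prefix_free U by case: optU => -[].
exists (2 ^+ d.+1); first by rewrite exprn_gt0.
move=> t u; wlog tu : t u / t <= u => [hwlog|] t01 u01.
  have [tu|/ltW ut] := leP t u; first exact: hwlog.
  by rewrite distrC [X in X `^ s]distrC; exact: hwlog.
have [<-|tu'] := eqVneq t u; first by rewrite subrr normr0 mulr_ge0// powR_ge0.
have {tu tu'} tu : t < u by rewrite lt_neqAle tu'.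
have /andP[t0 _] := t01; have /andP[_ u1] := u01.
have ut0 : 0 < u - t by rewrite subr_gt0.
have ex_m : exists m, (2^-1 : R) ^+ m <= u - t.
  exists (Num.truncn (u - t)^-1).+1.
  rewrite exprVn invf_ple ?posrE// ?exprn_gt0//.
  apply: le_trans (ltW (truncnS_gt _)) _.
  by rewrite -natrX ler_nat ltnW// ltn_expl.
(* As u - t < 1, the least exponent is a successor. *)
case: (ex_minnP ex_m) => -[|m].
  by rewrite expr0 => h _; exfalso; lra.
move=> mtu minm.
have utm : u - t < 2^-1 ^+ m.
  by rewrite ltNge; apply/negP => /minm; rewrite ltnn.
have [n [nm tun tn un]] := digit_split t0 tu u1 mtu.
have [leL_tu leL_u] := leL_gap tun tn un.
have [leLuu nleLut] := leL_u _ nm.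
have := sumL_gap R pfU leL_tu leLuu nleLut.
set p := mkseq _ _; set W := exp2N _ _ => gap.
have W0 : 0 <= W by exact: exp2N_ge0.
rewrite gtr0_norm// (ger0_norm (_ : 0 <= sumL R U (digit u) - _)); last by lra.
apply: (@le_trans _ _ (2 ^+ d.+1 * W `^ s)); last first.
  rewrite ler_wpM2l ?exprn_ge0//; apply: ge0_ler_powR; rewrite ?nnegrE//; lra.
apply: (@le_trans _ _ (2 ^+ d.+1 * 2^-1 ^+ (m.+1 + d))); last first.
  by rewrite ler_wpM2l ?exprn_ge0//; have := dP p; rewrite size_mkseq.
apply: le_trans (ltW utm) _.
by rewrite addSnnS addnC exprD mulrA -exprMn divff// expr1n mul1r.
Qed.

(** * Estimates of Hausdorff measure *)

Lemma diam_pow_ge0 (R : realType) (s : R) A : (0 <= diam_pow s A)%E.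
Proof. by rewrite /diam_pow; case: ifP => // _; exact: poweR_ge0. Qed.

Lemma hausdorff_content_ge0 (R : realType) (s d : R) A :
  (0 <= hausdorff_content s d A)%E.
Proof.
apply: le_ereal_inf_tmp => _ [C _ <-].
by apply: nneseries_ge0 => i _ _; exact: diam_pow_ge0.
Qed.

Lemma dist_le_diameter (R : realType) (A : set R) x y : A x -> A y ->
  (`|x - y|%:E <= diameter A)%E.
Proof. by move=> Ax Ay; apply: ereal_sup_ubound; exists (x, y). Qed.

Lemma diam_pow_ge (R : realType) (s : R) (A : set R) x y : 0 <= s ->
  A x -> A y -> ((`|x - y| `^ s)%:E <= diam_pow s A)%E.
Proof.
move=> s0 Ax Ay; rewrite /diam_pow ifF; last by apply/eqP => A0; rewrite A0 in Ax.
have := dist_le_diameter Ax Ay; rewrite -poweR_EFin => le_diam.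
apply: gt0_ler_poweR => //; rewrite in_itv/= leey andbT ?lee_fin//.
by apply: le_trans le_diam; rewrite lee_fin.
Qed.

Lemma diameter_itv (R : realType) (a b : R) : a <= b ->
  (diameter `[a, b] <= (b - a)%:E)%E.
Proof.
move=> ab; apply: ge_ereal_sup => _ [[x y] [/= + +] <-].
rewrite !in_itv/= => /andP[ax xb] /andP[ay yb].
by rewrite lee_fin ler_norml; apply/andP; split; lra.
Qed.

Lemma diam_pow_itv (R : realType) (s a b : R) : 0 <= s -> a <= b ->
  (diam_pow s `[a, b] <= ((b - a) `^ s)%:E)%E.
Proof.
move=> s0 ab; rewrite /diam_pow; case: ifP => _; first by rewrite lee_fin powR_ge0.
rewrite -poweR_EFin; apply: gt0_ler_poweR => //; last exact: diameter_itv.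
  rewrite in_itv/= leey andbT; have aab : [set` `[a, b]] a by rewrite /= in_itv/= lexx.
  by apply: le_trans (dist_le_diameter aab aab); rewrite lee_fin.
by rewrite in_itv/= leey andbT lee_fin subr_ge0.
Qed.

(** If g(t) is in a set C of the cover, all u with g(u) in C lie within
    K (diam C)^s of t. So a cover of A induces a cover of [0, 1[ by intervals of total
    length at most 2 K times its sum, which is therefore at least 1 / (2 K). *)
Lemma hausdorff_measure_neq0 (R : realType) (A : set R) (g : R -> R) (s K : R) :
  0 <= s -> 0 < K -> (forall t, 0 <= t < 1 -> A (g t)) ->
  (forall t u, 0 <= t < 1 -> 0 <= u < 1 -> `|u - t| <= K * `|g u - g t| `^ s) ->
  hausdorff_measure s A <> 0%E.
Proof.
move=> s0 K0 Ag gK A0.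
have /ereal_inf_ltP : (hausdorff_content s 1 A < (K *+ 2)^-1%:E)%E.
  apply: (@le_lt_trans _ _ 0%E); last by rewrite lte_fin invr_gt0 pmulrn_lgt0.
  by rewrite -A0; apply: ereal_sup_ubound; exists 1 => //=.
move=> [_ [C [AC Cdiam] <-]]; apply/negP; rewrite -leNgt.
have diam_fin i : A `&` C i !=set0 -> diam_pow s (C i) \is a fin_num.
  move=> [x [Ax Cx]]; rewrite /diam_pow; case: ifP => // _.
  apply: fin_num_poweR; rewrite ge0_fin_numE.
    by apply: le_lt_trans (Cdiam i) _; rewrite ltry.
  by apply: le_trans (dist_le_diameter Cx Cx); rewrite lee_fin.
pose D i := [set t | 0 <= t < 1 /\ C i (g t)].
have /choice[F FP] i : exists F : set R, [/\ measurable F, D i `<=` F &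
    (lebesgue_measure F <= (K *+ 2)%:E * diam_pow s (C i))%E].
  have [[t [t01 Ct]]|D0] := pselect (exists t, D i t); last first.
    exists set0; split => //; first by move=> t Dt; case: D0; exists t.
    by rewrite measure0 mule_ge0// ?diam_pow_ge0// lee_fin mulrn_wge0// ltW.
  have fin_r : diam_pow s (C i) \is a fin_num by apply: diam_fin; exists (g t); split=> //; exact: Ag.
  have rE := fineK fin_r; set r := fine _ in rE.
  have r0 : 0 <= r by apply: fine_ge0; exact: diam_pow_ge0.
  exists `[t - K * r, t + K * r]%classic; split=> //.
    move=> u [u01 Cu]; rewrite /= in_itv/= -ler_distl.
    apply: le_trans (gK t u t01 u01) _.
    by apply: ler_wpM2l; [exact: ltW | rewrite -lee_fin rE; exact: diam_pow_ge].
  rewrite lebesgue_measure_itv/= -rE; case: ifP => _; last first.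
    by rewrite -EFinM lee_fin mulr_ge0// mulrn_wge0// ltW.
  by rewrite -EFinB -EFinM lee_fin; lra.
have cover : `[0%R, 1%R[%classic `<=` \bigcup_i F i.
  move=> t; rewrite /= in_itv/= => t01.
  by have [i _ Ci] := AC _ (Ag t t01); exists i => //; case: (FP i) => _ DF _; apply: DF.
have mF i : measurable (F i) by case: (FP i).
have mu01 : (lebesgue_measure (`[0%R, 1%R[%classic : set R) = 1)%E.
  by rewrite lebesgue_measure_itv/= lte_fin ltr01 -EFinB subr0.
have le1 : (1 <= \sum_(0 <= i <oo) lebesgue_measure (F i))%E.
  rewrite -mu01.
  exact: (measure_sigma_subadditive (lebesgue_measure : {measure set _ -> \bar R})).
have : (1 <= (K *+ 2)%:E * \sum_(0 <= i <oo) diam_pow s (C i))%E.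
  apply: le_trans le1 _; rewrite -nneseriesZl; last by move=> *; exact: diam_pow_ge0.
  by apply: lee_nneseries => i *; [exact: measure_ge0|case: (FP i)].
by rewrite muleC -lee_pdivrMr ?pmulrn_lgt0// mul1e.
Qed.

(** Cutting [0, 1] into N intervals gives the sum N (1/N)^s = N^(1 - s), which
    tends to 0. *)
Lemma hausdorff_measure_sub01 (R : realType) (A : set R) (s : R) :
  1 < s -> (forall x, A x -> 0 <= x <= 1) -> hausdorff_measure s A = 0%E.
Proof.
move=> s1 A01; have s0 : 0 <= s by lra.
suff le0 d : 0 < d -> (hausdorff_content s d A <= 0)%E.
  apply/eqP; rewrite eq_le; apply/andP; split.
    by apply: ge_ereal_sup => _ [d d0 <-]; exact: le0.
  apply: le_trans (hausdorff_content_ge0 s 1 A) _.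
  by apply: ereal_sup_ubound; exists 1 => //=.
move=> d0; apply/lee_addgt0Pr => e e0; rewrite add0e.
(* N >= b is what makes N^(1 - s) <= e. *)
pose b := e^-1 `^ (s - 1)^-1.
pose N := (Num.truncn (Num.max d^-1 b)).+1.
have N0 : 0 < N%:R :> R by rewrite ltr0n.
have ltN : Num.max d^-1 b <= N%:R by exact/ltW/truncnS_gt.
have [dN bN] : d^-1 <= N%:R /\ b <= N%:R by move: ltN; rewrite ge_max => /andP.
pose C i : set R := if (i < N)%N then `[i%:R / N%:R, i.+1%:R / N%:R]%classic else set0.
have stepN i : i.+1%:R / N%:R - i%:R / N%:R = N%:R^-1 :> R.
  by rewrite -natr1 mulrDl mul1r addrAC subrr add0r.
have leN i : i%:R / N%:R <= i.+1%:R / N%:R :> R.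
  by rewrite -subr_ge0 stepN invr_ge0 ltW.
have CA : A `<=` \bigcup_i C i.
  move=> x /A01/andP[x0 x1].
  have xN0 : 0 <= x * N%:R by rewrite mulr_ge0// ltW.
  (* The right end point needs the last interval, not the one of index N. *)
  have [x1'|x1'] := eqVneq x 1.
    exists N.-1 => //; rewrite /C prednK// ltnSn /= in_itv/= x1'.
    rewrite divff ?gt_eqF// lexx andbT.
    by rewrite ler_pdivrMr// mul1r ler_nat.
  have {x1'}x1 : x < 1 by rewrite lt_neqAle x1'.
  exists (Num.truncn (x * N%:R)) => //.
  rewrite /C truncn_lt_nat// gtr_pMl// x1 /= in_itv/=.
  have /andP[h1 h2] := truncn_itv xN0.
  by rewrite ler_pdivrMr// ler_pdivlMr// h1 ltW.
apply: (@le_trans _ _ (\sum_(0 <= i <oo) diam_pow s (C i))%E).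
  apply: ereal_inf_lbound; exists C => //; split=> // i.
  rewrite /C; case: ifP => _; last first.
    by apply: ge_ereal_sup => _ [[x y] [[]]].
  apply: le_trans (diameter_itv (leN i)) _; rewrite stepN lee_fin.
  by rewrite invf_ple// posrE.
rewrite (nneseries_split 0 N); last by move=> *; exact: diam_pow_ge0.
rewrite [X in (_ + X)%E]eseries0 ?adde0; last first.
  move=> i; rewrite add0n => Ni _.
  by rewrite /C ltnNge Ni /= /diam_pow eqxx.
apply: (@le_trans _ _ (\sum_(0 <= i < 0 + N) (N%:R^-1 `^ s)%:E)%E).
  rewrite add0n big_mkord [leRHS]big_mkord; apply: lee_sum => i _.
  rewrite /C ltn_ord; apply: le_trans (diam_pow_itv s0 (leN i)) _.
  by rewrite stepN.
rewrite add0n sumEFin lee_fin sumr_const_nat subn0 -[_ *+ N]mulr_natl.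
rewrite -[N%:R^-1 : R]powR_inv1 ?(ltW N0)// -powRrM.
rewrite -{1}[N%:R : R]powRr1 ?(ltW N0)// -powRD; last first.
  by rewrite (gt_eqF N0) implybT.
have -> : 1 + -1 * s = - (s - 1) by ring.
rewrite powRN invf_ple ?posrE ?powR_gt0//.
have s10 : 0 < s - 1 by rewrite subr_gt0.
have -> : e^-1 = b `^ (s - 1).
  by rewrite -powRrM mulVf ?gt_eqF// powRr1// invr_ge0 ltW.
by apply: ge0_ler_powR; rewrite ?nnegrE ?powR_ge0// ltW.
Qed.

(** * Dimension of the range *)

Theorem theorem3p8 (R : realType) (U : seq bool -> option (seq bool)) (hU : optimal U) :
  hausdorff_dim (range (sumL R U)) = 1%E.
Proof.
have pfU : prefix_free U by case: hU => -[].
apply/eqP; rewrite eq_le; apply/andP; split.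
  apply/lee_addgt0Pr => e e0; apply: ereal_inf_lbound.
  exists (1 + e) => //; split; first by rewrite addr_ge0// ltW.
  apply: hausdorff_measure_sub01; first by rewrite ltrDl.
  by move=> _ [x _ <-]; exact: sumL_itv.
apply: le_ereal_inf_tmp => _ [s [s0 Hs0] <-]; rewrite lee_fin leNgt; apply/negP => s1.
have [K K0 gK] := @sumL_digit_expand R U s hU (introT andP (conj s0 s1)).
have range_digit t : 0 <= t < 1 -> range (sumL R U) ((sumL R U \o @digit R) t).
  by exists (digit t).
exact: (hausdorff_measure_neq0 s0 K0 range_digit gK Hs0).
Qed.
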